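(* $\mathbb{K}^{\mathsf S}$ is an endofunctor on $\mathsf{BA}^{\mathsf S}$.
   Context: A subordination relation $S\colon A\to B$ between boolean algebras is a relation $S\subseteq A\times B$ such that for all $a,b\in A$, $c,d\in B$: (S1) $0\,S\,0$ and $1\,S\,1$; (S2) $a\,S\,c$ and $b\,S\,c$ imply $(a\vee b)\,S\,c$; (S3) $a\,S\,c$ and $a\,S\,d$ imply $a\,S\,(c\wedge d)$; (S4) $a\le b\,S\,c\le d$ implies $a\,S\,d$. $\mathsf{BA}^{\mathsf S}$ is the category of boolean algebras and subordination relations; the identity on $B$ is the order $\le$ of $B$, and composition is relation composition ($x\,(T\circ S)\,z$ iff $\exists y$ with $x\,S\,y$ and $y\,T\,z$). $\mathsf{BA}^{\mathsf S}(A,B)$ is the set of subordinations $A\to B$ ordered by inclusion; it is a complete lattice. For a boolean algebra $B$, $\mathbb{K}(B)$ is the quotient of the free boolean algebra over the set of symbols $\{\Box_a\mid a\in B\}\cup\{\Diamond_a\mid a\in B\}$ by the relations $\Box_1=1$, $\Diamond_0=0$, $\Box_{a\wedge b}=\Box_a\wedge\Box_b$, $\Diamond_{a\vee b}=\Diamond_a\vee\Diamond_b$, $\Box_{a\vee b}\le\Box_a\vee\Diamond_b$, $\Box_a\wedge\Diamond_b\le\Diamond_{a\wedge b}$. The classes of $\Box_a,\Diamond_a$ are denoted by the same symbols. An element of $\mathbb{K}(B)$ is in disjunctive normal form if it is written as a finite join $\bigvee_{i=1}^n(\Box_{a_i}\wedge\Diamond_{b_{i1}}\wedge\cdots\wedge\Diamond_{b_{in_i}})$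 with $0\neq b_{ij}\le a_i$ for all $i,j$; it is in conjunctive normal form if it is written as a finite meet $\bigwedge_{j=1}^m(\Diamond_{c_j}\vee\Box_{d_{j1}}\vee\cdots\vee\Box_{d_{jm_j}})$ with $c_j\le d_{jk}\neq 1$ for all $j,k$ (empty joins and meets are allowed). For a subordination $S\colon A\to B$, define $\mathcal{S}_\Box,\mathcal{S}_\Diamond\colon\mathbb{K}(A)\to\mathbb{K}(B)$ as follows. $x\,\mathcal{S}_\Box\,y$ iff $x$ and $y$ can be written in disjunctive, respectively conjunctive, normal form (with the notation just given) so that for all $i\le n$, $j\le m$ there is $k\le m_j$ with $a_i\,S\,d_{jk}$. $x\,\mathcal{S}_\Diamond\,y$ iff $x$ and $y$ can be so written that for all $i\le n$, $j\le m$ there is $l\le n_i$ with $b_{il}\,S\,c_j$. Both are subordinations, and $\mathcal{S}$ is defined as the join $\mathcal{S}_\Box\vee\mathcal{S}_\Diamond$ in $\mathsf{BA}^{\mathsf S}(\mathbb{K}(A),\mathbb{K}(B))$. $\mathbb{K}^{\mathsf S}$ is given by $\mathbb{K}^{\mathsf S}(B)=\mathbb{K}(B)$ on boolean algebras and $\mathbb{K}^{\mathsf S}(S)=\mathcal{S}$ on subordinations. *)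

(* Defs.v *)
From HB Require Import structures.
Set Warnings "-notation-overridden,-redundant-canonical-projection".
From mathcomp Require Import all_boot all_order.
From mathcomp Require Import boolp.

Set Implicit Arguments.
Unset Strict Implicit.
Unset Printing Implicit Defensive.

Import Order.Theory.
Local Open Scope order_scope.
Local Open Scope quotient_scope.

Record category := Category {
  ob :> Type;
  hom : ob -> ob -> Type;
  idc : forall A, hom A A;
  (* diagrammatic argument order: [compc f g] is "f, then g" *)
  compc : forall A B C, hom A B -> hom B C -> hom A C;
  compc1l : forall A B (f : hom A B), compc (idc A) f = f;
  compc1r : forall A B (f : hom A B), compc f (idc B) = f;
  compcA : forall A B C D (f : hom A B) (g : hom B C) (h : hom C D),
    compc f (compc g h) = compc (compc f g) h }.

Definition is_functor (C D : category) (F0 : C -> D)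
    (F1 : forall A B : C, hom A B -> hom (F0 A) (F0 B)) : Prop :=
  (forall A : C, F1 A A (idc A) = idc (F0 A)) /\
  (forall (X Y Z : C) (f : hom X Y) (g : hom Y Z),
     F1 X Z (compc f g) = compc (F1 X Y f) (F1 Y Z g)).
Arguments is_functor C D F0 F1 : clear implicits.

(* [ctbDistrLatticeType] is the structure of boolean algebras; the degenerate
   algebra, in which [\bot = \top], is included.  The equality test and the
   choice operator it carries exist on every type by the axioms of [boolp]. *)

Record is_subordination {dA dB} (A : ctbDistrLatticeType dA)
    (B : ctbDistrLatticeType dB) (S : A -> B -> Prop) : Prop := IsSubordination {
  subord_bot : S \bot \bot;
  subord_top : S \top \top;
  subord_join : forall a b c, S a c -> S b c -> S (a `|` b) c;
  subord_meet : forall a c d, S a c -> S a d -> S a (c `&` d);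
  subord_le : forall a b c d, a <= b -> S b c -> c <= d -> S a d }.

Record subordination {dA dB} (A : ctbDistrLatticeType dA)
    (B : ctbDistrLatticeType dB) := Subordination {
  subord_rel :> A -> B -> Prop;
  subordP : is_subordination subord_rel }.

Lemma subord_ext {dA dB} (A : ctbDistrLatticeType dA)
    (B : ctbDistrLatticeType dB) (S T : subordination A B) :
  (forall a b, S a b <-> T a b) -> S = T.
Proof.
case: S T => [S SP] [T TP] /= ST.
have E : S = T by apply/funext => a; apply/funext => b; apply/propext/ST.
by subst T; rewrite (Prop_irrelevance SP TP).
Qed.

Lemma id_is_subordination {d} (B : ctbDistrLatticeType d) :
  is_subordination (fun a b : B => a <= b : Prop).
Proof.
split=> //.
- by move=> a b c; rewrite leUx => -> ->.
- by move=> a c e; rewrite lexI => -> ->.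
- by move=> a b c e ab bc /(le_trans bc); apply: le_trans.
Qed.

Definition subord_id {d} (B : ctbDistrLatticeType d) : subordination B B :=
  Subordination (id_is_subordination B).

Section Composition.
Context {dA dB dC} (A : ctbDistrLatticeType dA) (B : ctbDistrLatticeType dB)
  (C : ctbDistrLatticeType dC) (S : subordination A B) (T : subordination B C).

Definition comp_rel (x : A) (z : C) : Prop := exists y, S x y /\ T y z.

Lemma comp_is_subordination : is_subordination comp_rel.
Proof.
have [SP TP] := (subordP S, subordP T); split.
- by exists \bot; split; [exact: subord_bot SP|exact: subord_bot TP].
- by exists \top; split; [exact: subord_top SP|exact: subord_top TP].
- move=> a b c [y [Say Tyc]] [z [Sbz Tzc]]; exists (y `|` z); split.
    by apply: (subord_join SP); [apply: (subord_le SP (lexx _) Say)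
      |apply: (subord_le SP (lexx _) Sbz)]; rewrite ?leUl ?leUr.
  exact: (subord_join TP).
- move=> a c d [y [Say Tyc]] [z [Saz Tzd]]; exists (y `&` z); split.
    exact: (subord_meet SP).
  by apply: (subord_meet TP); [apply: (subord_le TP _ Tyc (lexx _))
    |apply: (subord_le TP _ Tzd (lexx _))]; rewrite ?leIl ?leIr.
- move=> a b c d ab [y [Sby Tyc]] cd; exists y; split.
    exact: (subord_le SP ab Sby).
  exact: (subord_le TP (lexx _) Tyc).
Qed.

(* The composite usually written [T o S]. *)
Definition subord_comp : subordination A C :=
  Subordination comp_is_subordination.

End Composition.

Section Join.
Context {dA dB} (A : ctbDistrLatticeType dA) (B : ctbDistrLatticeType dB).
Implicit Types S T U : subordination A B.

Definition subord_sub S T := forall a b, S a b -> T a b.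

Definition sup_rel S T (a : A) (b : B) : Prop :=
  forall U, subord_sub S U -> subord_sub T U -> U a b.

Lemma sup_is_subordination S T : is_subordination (sup_rel S T).
Proof.
split.
- by move=> U _ _; exact: subord_bot (subordP U).
- by move=> U _ _; exact: subord_top (subordP U).
- move=> a b c ac bc U SU TU.
  by apply: (subord_join (subordP U)); [exact: ac|exact: bc].
- move=> a c d ac ad U SU TU.
  by apply: (subord_meet (subordP U)); [exact: ac|exact: ad].
- move=> a b c d ab bc cd U SU TU.
  by apply: (subord_le (subordP U) ab _ cd); exact: bc.
Qed.

(* An intersection of subordinations is a subordination, so the join of two of
   them is the intersection of their common upper bounds. *)
Definition subord_sup S T : subordination A B :=
  Subordination (sup_is_subordination S T).

Lemma subord_supP S T :
  [/\ subord_sub S (subord_sup S T), subord_sub T (subord_sup S T)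
    & forall U, subord_sub S U -> subord_sub T U ->
        subord_sub (subord_sup S T) U].
Proof.
split=> [a b ab U SU _|a b ab U _ TU|U SU TU a b]; [exact: SU|exact: TU|].
by apply.
Qed.

End Join.

Record boolAlg := BoolAlg {
  ba_disp : Order.disp_t;
  ba_sort :> ctbDistrLatticeType ba_disp }.

Lemma subord_comp1l {dA dB} (A : ctbDistrLatticeType dA)
    (B : ctbDistrLatticeType dB) (S : subordination A B) :
  subord_comp (subord_id A) S = S.
Proof.
apply: subord_ext => a b; split=> [[y [/= ay]]|ab]; last by exists a => /=.
by move/(subord_le (subordP S) ay); apply.
Qed.

Lemma subord_comp1r {dA dB} (A : ctbDistrLatticeType dA)
    (B : ctbDistrLatticeType dB) (S : subordination A B) :
  subord_comp S (subord_id B) = S.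
Proof.
apply: subord_ext => a b; split=> [[y [ay /= yb]]|ab]; last by exists b => /=.
exact: (subord_le (subordP S) (lexx a) ay).
Qed.

Lemma subord_compA {d1 d2 d3 d4} (A : ctbDistrLatticeType d1)
    (B : ctbDistrLatticeType d2) (C : ctbDistrLatticeType d3)
    (D : ctbDistrLatticeType d4) (S : subordination A B)
    (T : subordination B C) (U : subordination C D) :
  subord_comp S (subord_comp T U) = subord_comp (subord_comp S T) U.
Proof.
apply: subord_ext => a d; split=> [[b [ab [c [bc cd]]]]|[c [[b [ab bc]] cd]]].
  by exists c; split=> //; exists b.
by exists b; split=> //; exists c.
Qed.

Definition BAS : category :=
  {| ob := boolAlg;
     hom := fun A B : boolAlg => subordination A B;
     idc := fun A : boolAlg => subord_id A;
     compc := fun A B C : boolAlg => @subord_comp _ _ _ A B C;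
     compc1l := fun A B : boolAlg => @subord_comp1l _ _ A B;
     compc1r := fun A B : boolAlg => @subord_comp1r _ _ A B;
     compcA := fun A B C D : boolAlg => @subord_compA _ _ _ _ A B C D |}.

Inductive bterm (X : Type) : Type :=
| Gen of X
| Bot
| Top
| Meet of bterm X & bterm X
| Join of bterm X & bterm X
| Compl of bterm X.
Arguments Bot {X}.
Arguments Top {X}.

HB.instance Definition _ (X : Type) := gen_eqMixin (bterm X).
HB.instance Definition _ (X : Type) := gen_choiceMixin (bterm X).

(* The least congruence on terms that contains the axioms of boolean algebras
   and the pairs in [R]. *)
Inductive bcong (X : Type) (R : bterm X -> bterm X -> Prop) :
  bterm X -> bterm X -> Prop :=
| bc_rel t s : R t s -> bcong R t s
| bc_refl t : bcong R t t
| bc_sym t s : bcong R t s -> bcong R s t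
| bc_trans t s u : bcong R t s -> bcong R s u -> bcong R t u
| bc_meet t t' s s' :
    bcong R t t' -> bcong R s s' -> bcong R (Meet t s) (Meet t' s')
| bc_join t t' s s' :
    bcong R t t' -> bcong R s s' -> bcong R (Join t s) (Join t' s')
| bc_compl t t' : bcong R t t' -> bcong R (Compl t) (Compl t')
| bc_meetC t s : bcong R (Meet t s) (Meet s t)
| bc_joinC t s : bcong R (Join t s) (Join s t)
| bc_meetA t s u : bcong R (Meet t (Meet s u)) (Meet (Meet t s) u)
| bc_joinA t s u : bcong R (Join t (Join s u)) (Join (Join t s) u)
| bc_joinKI t s : bcong R (Meet t (Join t s)) t
| bc_meetKU t s : bcong R (Join t (Meet t s)) t
| bc_meetUl t s u :
    bcong R (Meet (Join t s) u) (Join (Meet t u) (Meet s u))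
| bc_joint0 t : bcong R (Join t Bot) t
| bc_meett1 t : bcong R (Meet t Top) t
| bc_jointC t : bcong R (Join t (Compl t)) Top
| bc_meettC t : bcong R (Meet t (Compl t)) Bot.

Section Presentation.
Context (X : Type) (R : bterm X -> bterm X -> Prop).

Definition bcongb : rel (bterm X) := fun t s => `[< bcong R t s >].

Lemma bcongb_refl : reflexive bcongb.
Proof. by move=> t; apply/asboolP/bc_refl. Qed.

Lemma bcongb_sym : symmetric bcongb.
Proof. by move=> t s; apply/idP/idP => /asboolP /bc_sym /asboolP. Qed.

Lemma bcongb_trans : transitive bcongb.
Proof.
by move=> t s u /asboolP st /asboolP tu; apply/asboolP/(bc_trans st).
Qed.

Canonical bcong_equiv := EquivRel bcongb bcongb_refl bcongb_sym bcongb_trans.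

Definition presented : Type := {eq_quot bcong_equiv}.

HB.instance Definition _ := Choice.on presented.
HB.instance Definition _ := Quotient.on presented.

Lemma presented_eqP (t s : bterm X) :
  \pi_presented t = \pi_presented s <-> bcong R t s.
Proof.
split; last by move=> ts; apply/eqmodP/asboolP.
by move/eqmodP/asboolP.
Qed.

Definition pmeet (x y : presented) : presented :=
  \pi_presented (Meet (repr x) (repr y)).
Definition pjoin (x y : presented) : presented :=
  \pi_presented (Join (repr x) (repr y)).
Definition pcompl (x : presented) : presented :=
  \pi_presented (Compl (repr x)).
Definition ple (x y : presented) : bool := pmeet x y == x.
Definition plt (x y : presented) : bool := (y != x) && ple x y.

Let repr_cong t : bcong R (repr (\pi_presented t)) t.
Proof. by apply/presented_eqP; rewrite reprK. Qed.

Lemma pmeetE t s :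
  pmeet (\pi_presented t) (\pi_presented s) = \pi_presented (Meet t s).
Proof. by apply/presented_eqP/bc_meet. Qed.

Lemma pjoinE t s :
  pjoin (\pi_presented t) (\pi_presented s) = \pi_presented (Join t s).
Proof. by apply/presented_eqP/bc_join. Qed.

Lemma pcomplE t : pcompl (\pi_presented t) = \pi_presented (Compl t).
Proof. by apply/presented_eqP/bc_compl. Qed.

Lemma pmeetC : commutative pmeet.
Proof.
by elim/quotW=> t; elim/quotW=> s; rewrite 2!pmeetE; apply/presented_eqP/bc_meetC.
Qed.

Lemma pjoinC : commutative pjoin.
Proof.
by elim/quotW=> t; elim/quotW=> s; rewrite 2!pjoinE; apply/presented_eqP/bc_joinC.
Qed.

Lemma pmeetA : associative pmeet.
Proof.
elim/quotW=> t; elim/quotW=> s; elim/quotW=> u.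
by rewrite (pmeetE s u) (pmeetE t s) 2!pmeetE; apply/presented_eqP/bc_meetA.
Qed.

Lemma pjoinA : associative pjoin.
Proof.
elim/quotW=> t; elim/quotW=> s; elim/quotW=> u.
by rewrite (pjoinE s u) (pjoinE t s) 2!pjoinE; apply/presented_eqP/bc_joinA.
Qed.

Lemma pjoinKI y x : pmeet x (pjoin x y) = x.
Proof.
elim/quotW: x => t; elim/quotW: y => s.
by rewrite (pjoinE t s) pmeetE; apply/presented_eqP/bc_joinKI.
Qed.

Lemma pmeetKU y x : pjoin x (pmeet x y) = x.
Proof.
elim/quotW: x => t; elim/quotW: y => s.
by rewrite (pmeetE t s) pjoinE; apply/presented_eqP/bc_meetKU.
Qed.

Lemma pmeetUl : left_distributive pmeet pjoin.
Proof.
elim/quotW=> t; elim/quotW=> s; elim/quotW=> u.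
rewrite (pjoinE t s) (pmeetE t u) (pmeetE s u) pmeetE pjoinE.
exact/presented_eqP/bc_meetUl.
Qed.

Lemma pmeetxx : idempotent_op pmeet.
Proof. by move=> x; rewrite -{2}(pmeetKU x x) pjoinKI. Qed.

Lemma presented_display : Order.disp_t. Proof. by constructor. Qed.

HB.instance Definition _ :=
  @Order.isMeetJoinDistrLattice.Build presented_display presented
    ple plt pmeet pjoin (fun _ _ => erefl) (fun _ _ => erefl)
    pmeetC pjoinC pmeetA pjoinA pjoinKI pmeetKU pmeetUl pmeetxx.

Lemma ple0x (x : presented) : (\pi_presented Bot : presented) <= x.
Proof.
elim/quotW: x => t; apply/eqP; rewrite pmeetC pmeetE; apply/presented_eqP.
have E := bc_meet (bc_refl R t) (bc_sym (bc_meettC R t)).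
apply: (bc_trans E); apply: (bc_trans (bc_meetA R _ _ _)).
apply: (bc_trans _ (bc_meettC R t)); apply: bc_meet (bc_refl _ _).
by apply/presented_eqP; rewrite -pmeetE pmeetxx.
Qed.

Lemma plex1 (x : presented) : x <= (\pi_presented Top : presented).
Proof.
by elim/quotW: x => t; apply/eqP; rewrite pmeetE; apply/presented_eqP/bc_meett1.
Qed.

HB.instance Definition _ :=
  @Order.hasBottom.Build presented_display presented (\pi_presented Bot) ple0x.
HB.instance Definition _ :=
  @Order.hasTop.Build presented_display presented (\pi_presented Top) plex1.

Lemma pjoinxC (x : presented) : x `|` pcompl x = \top.
Proof.
elim/quotW: x => t; rewrite pcomplE [LHS]pjoinE.
exact/presented_eqP/bc_jointC.
Qed.

Lemma pmeetxC (x : presented) : x `&` pcompl x = \bot.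
Proof.
elim/quotW: x => t; rewrite pcomplE [LHS]pmeetE.
exact/presented_eqP/bc_meettC.
Qed.

HB.instance Definition _ :=
  @Order.TBDistrLattice_hasComplement.Build presented_display presented
    pcompl pjoinxC pmeetxC.


Lemma presentedW (P : presented -> Prop) :
    (forall a, P (\pi_presented (Gen a))) -> P \bot -> P \top ->
    (forall x y, P x -> P y -> P (x `&` y)) ->
    (forall x y, P x -> P y -> P (x `|` y)) ->
    (forall x, P x -> P (~` x)) ->
  forall x, P x.
Proof.
move=> Pg P0 P1 PI PU PC; elim/quotW; elim=> [a| | |t Pt s Ps|t Pt s Ps|t Pt].
- exact: Pg.
- exact: P0.
- exact: P1.
- by rewrite -pmeetE; apply: PI.
- by rewrite -pjoinE; apply: PU.
- by rewrite -pcomplE; apply: PC.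
Qed.

End Presentation.

Section Evaluation.
Context (X : Type) {d} (L : ctbDistrLatticeType d) (f : X -> L).

Fixpoint beval (t : bterm X) : L :=
  match t with
  | Gen a => f a
  | Bot => \bot
  | Top => \top
  | Meet t s => beval t `&` beval s
  | Join t s => beval t `|` beval s
  | Compl t => ~` beval t
  end.

Context (R : bterm X -> bterm X -> Prop)
  (fR : forall t s, R t s -> beval t = beval s).

Lemma beval_bcong t s : bcong R t s -> beval t = beval s.
Proof.
elim=> //=.
- by move=> u v w _ -> _ ->.
- by move=> u u' v v' _ -> _ ->.
- by move=> u u' v v' _ -> _ ->.
- by move=> u u' _ ->.
- by move=> u v; rewrite meetC.
- by move=> u v; rewrite joinC.
- by move=> u v w; rewrite meetA.
- by move=> u v w; rewrite joinA.
- by move=> u v; rewrite joinKI.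
- by move=> u v; rewrite meetKU.
- by move=> u v w; rewrite meetUl.
- by move=> u; rewrite joinx0.
- by move=> u; rewrite meetx1.
- by move=> u; rewrite joinxC.
- by move=> u; rewrite meetxC.
Qed.

Definition plift (x : presented R) : L := beval (repr x).

Lemma pliftE t : plift (\pi_(presented R) t) = beval t.
Proof. by apply: beval_bcong; apply/presented_eqP; rewrite reprK. Qed.

Lemma plift0 : plift \bot = \bot. Proof. exact: pliftE. Qed.
Lemma plift1 : plift \top = \top. Proof. exact: pliftE. Qed.
Lemma pliftI x y : plift (x `&` y) = plift x `&` plift y.
Proof. exact: pliftE. Qed.
Lemma pliftU x y : plift (x `|` y) = plift x `|` plift y.
Proof. exact: pliftE. Qed.
Lemma plift_le x y : x <= y -> plift x <= plift y.
Proof. by move=> /meet_idPl xy; apply/meet_idPl; rewrite -pliftI xy. Qed.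

End Evaluation.

Inductive ksym (B : Type) := Box of B | Dia of B.

Section KAlgebra.
Context {d} (B : ctbDistrLatticeType d).
Implicit Types a b c : B.

Local Notation tbox a := (Gen (Box a)).
Local Notation tdia a := (Gen (Dia a)).

(* In the last two clauses [u <= v] is written [u `&` v = u]. *)
Inductive krel : bterm (ksym B) -> bterm (ksym B) -> Prop :=
| kr_box1 : krel (tbox \top) Top
| kr_dia0 : krel (tdia \bot) Bot
| kr_boxI a b : krel (tbox (a `&` b)) (Meet (tbox a) (tbox b))
| kr_diaU a b : krel (tdia (a `|` b)) (Join (tdia a) (tdia b))
| kr_boxU a b :
    krel (Meet (tbox (a `|` b)) (Join (tbox a) (tdia b))) (tbox (a `|` b))
| kr_diaI a b :
    krel (Meet (Meet (tbox a) (tdia b)) (tdia (a `&` b)))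
         (Meet (tbox a) (tdia b)).

Definition K : ctbDistrLatticeType presented_display := presented krel.

Definition kbox a : K := \pi_(presented krel) (Gen (Box a)).
Definition kdia a : K := \pi_(presented krel) (Gen (Dia a)).

Lemma kbox1 : kbox \top = \top.
Proof. exact/presented_eqP/bc_rel/kr_box1. Qed.
Lemma kdia0 : kdia \bot = \bot.
Proof. exact/presented_eqP/bc_rel/kr_dia0. Qed.
Lemma kboxI a b : kbox (a `&` b) = kbox a `&` kbox b.
Proof. rewrite [RHS]pmeetE; exact/presented_eqP/bc_rel/kr_boxI. Qed.
Lemma kdiaU a b : kdia (a `|` b) = kdia a `|` kdia b.
Proof. rewrite [RHS]pjoinE; exact/presented_eqP/bc_rel/kr_diaU. Qed.
Lemma kboxU_le a b : kbox (a `|` b) <= kbox a `|` kdia b.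
Proof.
apply/meet_idPl; rewrite [_ `|` kdia b]pjoinE [LHS]pmeetE.
exact/presented_eqP/bc_rel/kr_boxU.
Qed.
Lemma kdiaI_ge a b : kbox a `&` kdia b <= kdia (a `&` b).
Proof.
apply/meet_idPl; rewrite [kbox a `&` _]pmeetE [LHS]pmeetE.
exact/presented_eqP/bc_rel/kr_diaI.
Qed.

Lemma kboxC a : ~` kbox a = kdia (~` a).
Proof.
apply: le_anti; apply/andP; split.
  rewrite -[leLHS]meetx1 -kbox1 -(joinxC a).
  apply: le_trans (leI2 (lexx _) (kboxU_le a (~` a))) _.
  by rewrite meetUr meetC meetxC join0x leIr.
rewrite -disj_leC meetC -lex0.
by apply: le_trans (kdiaI_ge _ _) _; rewrite meetxC kdia0.
Qed.

Lemma kdiaC a : ~` kdia a = kbox (~` a).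
Proof. by rewrite -{1}[a]complK -kboxC complK. Qed.

Lemma kdia_le a b : a <= b -> kdia a <= kdia b.
Proof. by move=> /join_idPl <-; rewrite kdiaU leUr. Qed.

Lemma kboxdia a b : kbox a `&` kdia b = kbox a `&` kdia (a `&` b).
Proof.
apply: le_anti; rewrite !lexI !leIl kdiaI_ge /=.
by rewrite (le_trans (leIr _ _)) // kdia_le // leIr.
Qed.

(* The pair [(a, [:: b_1; ...; b_n])] encodes
   [kbox a `&` kdia b_1 `&` ... `&` kdia b_n] in a disjunctive form, and
   [kdia a `|` kbox b_1 `|` ... `|` kbox b_n] in a conjunctive form. *)

Definition dnf_val (s : seq (B * seq B)) : K :=
  \join_(p <- s) (kbox p.1 `&` \meet_(b <- p.2) kdia b).

Definition cnf_val (s : seq (B * seq B)) : K :=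
  \meet_(q <- s) (kdia q.1 `|` \join_(e <- q.2) kbox e).

Definition is_dnf (x : K) (s : seq (B * seq B)) : Prop :=
  x = dnf_val s /\
  forall p, p \in s -> forall b, b \in p.2 -> b != \bot /\ b <= p.1.

Definition is_cnf (y : K) (s : seq (B * seq B)) : Prop :=
  y = cnf_val s /\
  forall q, q \in s -> forall e, e \in q.2 -> q.1 <= e /\ e != \top.

Lemma kboxdias a (s : seq B) :
  kbox a `&` \meet_(b <- s) kdia b =
  kbox a `&` \meet_(b <- [seq a `&` b | b <- s]) kdia b.
Proof.
elim: s => [|b s IHs]; rewrite ?big_nil //= !big_cons.
by rewrite meetA kboxdia meetAC IHs meetAC -meetA.
Qed.

Lemma dnf_bot : is_dnf \bot [::].
Proof. by split=> //; rewrite /dnf_val big_nil. Qed.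

Lemma cnf_top : is_cnf \top [::].
Proof. by split=> //; rewrite /cnf_val big_nil. Qed.

Lemma dnf_top : is_dnf \top [:: (\top, [::])].
Proof.
split; first by rewrite /dnf_val big_seq1 /= big_nil meetx1 kbox1.
by move=> p; rewrite inE => /eqP ->.
Qed.

Lemma cnf_bot : is_cnf \bot [:: (\bot, [::])].
Proof.
split; first by rewrite /cnf_val big_seq1 /= big_nil joinx0 kdia0.
by move=> q; rewrite inE => /eqP ->.
Qed.

Lemma dnf_join x y s t : is_dnf x s -> is_dnf y t -> is_dnf (x `|` y) (s ++ t).
Proof.
move=> [-> sP] [-> tP]; split; first by rewrite /dnf_val big_cat.
by move=> p; rewrite mem_cat => /orP[]; [exact: sP|exact: tP].
Qed.

Lemma cnf_meet x y s t : is_cnf x s -> is_cnf y t -> is_cnf (x `&` y) (s ++ t).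
Proof.
move=> [-> sP] [-> tP]; split; first by rewrite /cnf_val big_cat.
by move=> p; rewrite mem_cat => /orP[]; [exact: sP|exact: tP].
Qed.

Lemma dnf_conj a (s : seq B) :
  exists t, is_dnf (kbox a `&` \meet_(b <- s) kdia b) t.
Proof.
rewrite kboxdias; set r := [seq _ | _ <- s].
have [r0|r0] := boolP (\bot \in r).
  exists [::]; rewrite (_ : _ `&` _ = \bot); first exact: dnf_bot.
  apply/eqP; rewrite -lex0; apply: le_trans (leIr _ _) _.
  by rewrite -kdia0; apply: meets_inf_seq.
exists [:: (a, r)]; split; first by rewrite /dnf_val big_seq1.
move=> p; rewrite inE => /eqP -> b /= br; split.
  by apply: contraNneq r0 => <-.
by case/mapP: br => c _ ->; exact: leIl.
Qed.

Lemma dnf_joins (I : Type) (r : seq I) (F : I -> K) :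
  (forall i, exists t, is_dnf (F i) t) -> exists t, is_dnf (\join_(i <- r) F i) t.
Proof.
move=> FP; elim: r => [|i r [t tP]].
  by rewrite big_nil; exists [::]; exact: dnf_bot.
by rewrite big_cons; case: (FP i) => u uP; exists (u ++ t); exact: dnf_join.
Qed.

Lemma dnf_meet x y : (exists s, is_dnf x s) -> (exists t, is_dnf y t) ->
  exists u, is_dnf (x `&` y) u.
Proof.
move=> [s [-> _]] [t [-> _]]; rewrite /dnf_val.
rewrite (big_morph _ (fun u v => meetUl u v _) (meet0x _)).
apply: dnf_joins => p; rewrite (big_morph _ (meetUr _) (meetx0 _)).
apply: dnf_joins => q.
by rewrite meetACA -kboxI -big_cat; exact: dnf_conj.
Qed.

Lemma dnf_exists x : exists s, is_dnf x s.
Proof.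
suff [] : (exists s, is_dnf x s) /\ (exists s, is_dnf (~` x) s) by [].
have boxP a : exists s, is_dnf (kbox a) s.
  by have := dnf_conj a [::]; rewrite big_nil meetx1.
have diaP a : exists s, is_dnf (kdia a) s.
  by have := dnf_conj \top [:: a]; rewrite big_seq1 kbox1 meet1x.
elim/presentedW: x => [[] a| | |x y [xP nxP] [yP nyP]
                       |x y [xP nxP] [yP nyP]|x [xP nxP]].
- by split; [exact: boxP|rewrite [~` _]kboxC; exact: diaP].
- by split; [exact: diaP|rewrite [~` _]kdiaC; exact: boxP].
- by rewrite compl0; split; eexists; [exact: dnf_bot|exact: dnf_top].
- by rewrite compl1; split; eexists; [exact: dnf_top|exact: dnf_bot].
- split; first exact: dnf_meet.
  case: nxP nyP => [s sP] [t tP]; exists (s ++ t).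
  by rewrite complI; exact: dnf_join.
- split; last by rewrite complU; exact: dnf_meet.
  by case: xP yP => [s sP] [t tP]; exists (s ++ t); exact: dnf_join.
- by rewrite complK.
Qed.

Lemma cnf_exists y : exists t, is_cnf y t.
Proof.
have [s [yE sP]] := dnf_exists (~` y).
exists [seq (~` p.1, [seq ~` b | b <- p.2]) | p <- s]; split.
  rewrite -[y]complK yE compl_joins /cnf_val big_map; apply: eq_bigr => p _ /=.
  rewrite complI kboxC compl_meets big_map; congr (_ `|` _).
  by apply: eq_bigr => b _; rewrite kdiaC.
move=> _ /mapP[p ps ->] _ /mapP[b bp ->] /=.
have [b0 bp1] := sP p ps b bp; rewrite leC; split=> //.
by apply: contra_neq b0 => nb; rewrite -[b]complK nb compl1.
Qed.

(* A filter [F] of [B] is a closed set of the dual space of [B], that is, a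
   point of the dual space of [K]; [kpt F] is the homomorphism it induces. *)

Record is_filter (F : B -> Prop) : Prop := IsFilter {
  filter_top : F \top;
  filter_meet : forall a b, F a -> F b -> F (a `&` b);
  filter_le : forall a b, a <= b -> F a -> F b }.

Section FilterPoint.
Variables (F : B -> Prop) (FP : is_filter F).

Definition ksym_val (s : ksym B) : bool :=
  match s with Box a => `[< F a >] | Dia a => ~~ `[< F (~` a) >] end.

Lemma ksym_val_krel t s :
  krel t s -> beval ksym_val t = beval ksym_val s.
Proof.
have [F1 FI Fle] := FP.
have FIE a b : F (a `&` b) <-> F a /\ F b.
  split=> [Fab|[]]; last exact: FI.
  by split; apply: Fle Fab; rewrite ?leIl ?leIr.
case=> {t s} /= [||a b|a b|a b|a b].
- exact/asboolP.
- by rewrite compl0; apply/negbTE; rewrite negbK; apply/asboolP.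
- by apply/asboolP/andP => [/FIE[/asboolP ? /asboolP ?]|
    [/asboolP ? /asboolP ?]]; [split|apply/FIE].
- rewrite complU; apply: negb_inj; rewrite [in RHS]negb_or !negbK.
  by apply/asboolP/andP => [/FIE[/asboolP ? /asboolP ?]|
    [/asboolP ? /asboolP ?]]; [split|apply/FIE].
- apply/andb_idr => /asboolP Fab; apply/orP.
  case: (boolP `[< F (~` b) >]) => [/asboolP Fb|]; last by right.
  left; apply/asboolP; apply: Fle (FI _ _ Fab Fb).
  by rewrite meetUl meetxC joinx0 leIl.
- apply/andb_idr => /andP[/asboolP Fa]; apply: contra => /asboolP Fab.
  apply/asboolP; apply: Fle (FI _ _ Fa Fab).
  by rewrite complI meetUr meetxC join0x leIr.
Qed.

Definition kpt : K -> bool := @plift _ _ _ ksym_val krel.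

Lemma kpt_meet x y : kpt (x `&` y) = kpt x && kpt y.
Proof. exact: (pliftI ksym_val_krel). Qed.

Lemma kpt_join x y : kpt (x `|` y) = kpt x || kpt y.
Proof. exact: (pliftU ksym_val_krel). Qed.

Lemma kpt_box a : kpt (kbox a) = `[< F a >].
Proof. exact: (pliftE ksym_val_krel). Qed.

Lemma kpt_dia a : kpt (kdia a) = ~~ `[< F (~` a) >].
Proof. exact: (pliftE ksym_val_krel). Qed.

Lemma kpt_le x y : x <= y -> kpt x -> kpt y.
Proof. by move=> /meet_idPl <-; rewrite kpt_meet => /andP[]. Qed.

Lemma kpt_joins (I : Type) (r : seq I) (G : I -> K) :
  kpt (\join_(i <- r) G i) = has (fun i => kpt (G i)) r.
Proof.
elim: r => [|i r IHr]; first by rewrite big_nil; exact: (plift0 ksym_val_krel).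
by rewrite big_cons /= -IHr kpt_join.
Qed.

Lemma kpt_meets (I : Type) (r : seq I) (G : I -> K) :
  kpt (\meet_(i <- r) G i) = all (fun i => kpt (G i)) r.
Proof.
elim: r => [|i r IHr]; first by rewrite big_nil; exact: (plift1 ksym_val_krel).
by rewrite big_cons /= -IHr kpt_meet.
Qed.

Lemma kpt_dnfP (s : seq (B * seq B)) : reflect
  (exists p, [/\ p \in s, F p.1 & forall b, b \in p.2 -> ~ F (~` b)])
  (kpt (dnf_val s)).
Proof.
have pP (p : B * seq B) : reflect (F p.1 /\ forall b, b \in p.2 -> ~ F (~` b))
    (kpt (kbox p.1 `&` \meet_(b <- p.2) kdia b)).
  rewrite kpt_meet kpt_box kpt_meets.
  apply: (iffP andP) => -[/asboolP Fp bP]; split=> //.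
    by move=> b /(allP bP); rewrite kpt_dia => /asboolPn.
  by apply/allP => b /bP ?; rewrite kpt_dia; apply/asboolPn.
rewrite kpt_joins; apply: (iffP hasP) => [[p ps /pP[]]|[p [ps ? ?]]].
  by exists p.
by exists p => //; apply/pP.
Qed.

Lemma kpt_cnfPn (t : seq (B * seq B)) : reflect
  (exists q, [/\ q \in t, F (~` q.1) & forall e, e \in q.2 -> ~ F e])
  (~~ kpt (cnf_val t)).
Proof.
have qP (q : B * seq B) : reflect (F (~` q.1) /\ forall e, e \in q.2 -> ~ F e)
    (~~ kpt (kdia q.1 `|` \join_(e <- q.2) kbox e)).
  rewrite kpt_join kpt_dia kpt_joins negb_or negbK.
  apply: (iffP andP) => -[/asboolP Fq eP]; split=> //.
    by move=> e /(hasPn eP); rewrite kpt_box => /asboolPn.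
  by apply/hasPn => e /eP ?; rewrite kpt_box; apply/asboolPn.
rewrite kpt_meets; apply: (iffP allPn) => [[q qt /qP[]]|[q [qt ? ?]]].
  by exists q.
by exists q => //; apply/qP.
Qed.

End FilterPoint.

Lemma principal_filter a : is_filter (fun b => a <= b : Prop).
Proof.
split=> [|b c ab ac|b c bc ab]; [exact: lex1|by rewrite lexI ab ac|].
exact: le_trans bc.
Qed.

End KAlgebra.

Section KSubordination.
Context {dA dB} (A : ctbDistrLatticeType dA) (B : ctbDistrLatticeType dB)
  (S : subordination A B).

Definition box_cond (p : A * seq A) (q : B * seq B) : Prop :=
  exists2 e, e \in q.2 & S p.1 e.

Definition dia_cond (p : A * seq A) (q : B * seq B) : Prop :=
  exists2 b, b \in p.2 & S b q.1.

Definition ks_rel (P : A * seq A -> B * seq B -> Prop) (x : K A) (y : K B) :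
    Prop :=
  exists (s : seq (A * seq A)) (t : seq (B * seq B)),
    [/\ is_dnf x s, is_cnf y t
      & forall p, p \in s -> forall q, q \in t -> P p q].

Definition ks_box : K A -> K B -> Prop := ks_rel box_cond.
Definition ks_dia : K A -> K B -> Prop := ks_rel dia_cond.

Section Relation.
Variable P : A * seq A -> B * seq B -> Prop.

Let Pall (s : seq (A * seq A)) (t : seq (B * seq B)) :=
  forall p, p \in s -> forall q, q \in t -> P p q.

Hypothesis PL : forall (x x' : K A) (y : K B) s s' t,
  is_dnf x s -> is_dnf x' s' -> is_cnf y t -> x' <= x -> Pall s t -> Pall s' t.
Hypothesis PR : forall (x : K A) (y y' : K B) s t t',
  is_dnf x s -> is_cnf y t -> is_cnf y' t' -> y <= y' -> Pall s t -> Pall s t'.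

Lemma ks_rel_is_subordination : is_subordination (ks_rel P).
Proof.
split.
- by exists [::], [:: (\bot, [::])]; split=> //; [exact: dnf_bot|exact: cnf_bot].
- by exists [:: (\top, [::])], [::]; split=> //; [exact: dnf_top|exact: cnf_top].
- move=> a b c [s [t [sP tP st]]] [s' [t' [sP' tP' st']]].
  exists (s ++ s'), t; split=> //; first exact: dnf_join.
  move=> p; rewrite mem_cat => /orP[]; first exact: st.
  exact: (PR sP' tP' tP).
- move=> a c d [s [t [sP tP st]]] [s' [t' [sP' tP' st']]].
  exists s, (t ++ t'); split=> //; first exact: cnf_meet.
  move=> p ps q; rewrite mem_cat => /orP[]; first exact: st.
  exact: (PL sP' sP tP').
- move=> a b c d ab [s [t [sP tP st]]] cd.
  have [s' sP'] := dnf_exists a; have [t' tP'] := cnf_exists d.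
  exists s', t'; split=> //.
  exact: (PL sP sP' tP' ab (PR sP tP tP' cd st)).
Qed.

End Relation.

Lemma ks_box_is_subordination : is_subordination ks_box.
Proof.
have SP := subordP S.
apply: ks_rel_is_subordination.
  move=> x x' y s s' t [xs _] [xs' sP'] _ xx st p' ps' q qt.
  pose F b := p'.1 <= b : Prop.
  have FP : is_filter F := principal_filter p'.1.
  have : kpt F x'.
    rewrite xs'; apply/(kpt_dnfP FP); exists p'; split=> //; first exact: lexx.
    move=> b /(sP' _ ps')[b0 bp] pnb; move/negP: b0; apply.
    by rewrite -lex0 -(meetxC b) lexI lexx (le_trans bp).
  move=> /(kpt_le FP xx); rewrite xs => /(kpt_dnfP FP)[p [ps Fp _]].
  have [e eq Spe] := st _ ps _ qt; exists e => //.
  exact: (subord_le SP Fp Spe (lexx e)).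
move=> x y y' s t t' _ [yt _] [yt' tP'] yy st p ps q' qt'.
apply: contrapT => nbox.
pose F e := exists2 f, S p.1 f & f `&` ~` q'.1 <= e.
have FP : is_filter F.
  split.
  - by exists \top; [exact: (subord_le SP (lex1 _) (subord_top SP) (lexx _))|exact: lex1].
  - move=> a b [f Sf fa] [g Sg gb]; exists (f `&` g).
      exact: (subord_meet SP).
    rewrite lexI (le_trans _ fa) ?(le_trans _ gb) // leI2 // ?leIl ?leIr //.
  - by move=> a b ab [f Sf fa]; exists f => //; apply: le_trans ab.
have : ~~ kpt F y'.
  rewrite yt'; apply/(kpt_cnfPn FP); exists q'; split=> //.
    exists \top; last exact: leIr.
    exact: (subord_le SP (lex1 _) (subord_top SP) (lexx _)).
  move=> e eq' [f Sf fe]; apply: nbox; exists e => //.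
  apply: (subord_le SP (lexx _) Sf).
  have [qe _] := tP' _ qt' _ eq'.
  rewrite -[f]meetx1 -(joinxC q'.1) meetUr leUx fe.
  by rewrite (le_trans (leIr _ _)).
move=> /(contra (kpt_le FP yy)); rewrite yt => /(kpt_cnfPn FP)[q [qt _ qP]].
have [e eq Spe] := st _ ps _ qt.
by apply: (qP _ eq); exists e => //; exact: leIl.
Qed.

Lemma ks_dia_is_subordination : is_subordination ks_dia.
Proof.
have SP := subordP S.
apply: ks_rel_is_subordination.
  move=> x x' y s s' t [xs _] [xs' sP'] _ xx st p' ps' q qt.
  apply: contrapT => ndia.
  pose F e := exists2 b, S b q.1 & p'.1 `&` ~` b <= e.
  have S0 : S \bot q.1 := subord_le SP (lexx _) (subord_bot SP) (le0x _).
  have FP : is_filter F.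
    split.
    - by exists \bot => //; exact: lex1.
    - move=> a b [f Sf fa] [g Sg gb]; exists (f `|` g).
        exact: (subord_join SP).
      by rewrite complU lexI (le_trans _ fa) ?(le_trans _ gb) // leI2 ?leIl ?leIr.
    - by move=> a b ab [f Sf fa]; exists f => //; apply: le_trans ab.
  have : kpt F x'.
    rewrite xs'; apply/(kpt_dnfP FP); exists p'; split=> //.
      by exists \bot => //; exact: leIl.
    move=> b bp' [f Sf fb]; apply: ndia; exists b => //.
    apply: (subord_le SP _ Sf (lexx _)).
    have [_ bp1] := sP' _ ps' _ bp'.
    rewrite -[f]complK -disj_leC -lex0 -(meetxC b) lexI leIl /=.
    by apply: le_trans fb; rewrite leI2.
  move=> /(kpt_le FP xx); rewrite xs => /(kpt_dnfP FP)[p [ps _ pP]].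
  have [b bp Sb] := st _ ps _ qt.
  by apply: (pP _ bp); exists b => //; exact: leIr.
move=> x y y' s t t' _ [yt _] [yt' tP'] yy st p ps q' qt'.
pose F b := ~` q'.1 <= b : Prop.
have FP : is_filter F := principal_filter (~` q'.1).
have : ~~ kpt F y'.
  rewrite yt'; apply/(kpt_cnfPn FP); exists q'; split=> //; first exact: lexx.
  move=> e /(tP' _ qt')[qe e1] nqe; move/negP: e1; apply.
  by rewrite -le1x -(joinxC q'.1) leUx qe.
move=> /(contra (kpt_le FP yy)); rewrite yt => /(kpt_cnfPn FP)[q [qt Fq _]].
have [b bp Sb] := st _ ps _ qt; exists b => //.
by apply: (subord_le SP (lexx _) Sb); rewrite -leC.
Qed.

Definition ks_subord : subordination (K A) (K B) :=
  subord_sup (Subordination ks_box_is_subordination)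
             (Subordination ks_dia_is_subordination).

End KSubordination.

Definition KS_ob (B : BAS) : BAS := BoolAlg (K B).

Definition KS_hom (A B : BAS) (S : hom A B) : hom (KS_ob A) (KS_ob B) :=
  ks_subord S.

(* Main.v *)
Require Import Defs.
Set Warnings "-notation-overridden".
From mathcomp Require Import all_boot all_order.
From mathcomp Require Import boolp.

(** The algebra [K B] is dual to the hyperspace of closed subsets of the Stone
    space of [B].  A filter stands for a closed set, and [kpt F x] says that
    the closed set [F] belongs to the clopen set [x].  A subordination [S] is
    dual to a closed relation, and [ks_subord S] is dual to its Egli-Milner
    lifting, which relates closed sets [F] and [G] when every point of [F] is
    related to a point of [G] and vice versa.

    The heart of the proof is that [x] and [y] are in [ks_subord S] exactly
    when [kpt F x] implies [kpt G y] for all Egli-Milner related filters [F]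
    and [G] ([ks_subordP]).  The filter condition defines a subordination that
    contains both of the relations whose join is [ks_subord S].  Conversely, if
    a term of the disjunctive form of [x] and a term of the conjunctive form of
    [y] satisfy neither the box nor the diamond condition, then the largest
    Egli-Milner pair whose first member lies inside the boxed element of the
    first term, and whose second member avoids the element under the diamond of
    the second term, violates the filter condition ([em_le_nf]).  So the box condition or the diamond condition holds for each
    pair of terms, and finite joins and meets assemble these pairs.

    Functoriality follows.  The Egli-Milner lifting of equality is equality,
    and termwise the two conditions for the order say that one box or diamond
    lies below another.  For composites, an Egli-Milner pair for [S] followed
    by [T] factors through a middle closed set ([egli_milner_comp]); conversely
    a middle element witnessing the box or diamond condition for the composite
    yields a middle box or diamond in [K]. *)

Set Implicit Arguments.
Unset Strict Implicit.
Unset Printing Implicit Defensive.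

Import Order.Theory.
Local Open Scope order_scope.

(** * Generalities on subordinations *)

Lemma subord_le0x {dA dB} (A : ctbDistrLatticeType dA)
    (B : ctbDistrLatticeType dB) (S : subordination A B) b : S \bot b.
Proof.
exact: (subord_le (subordP S) (lexx _) (subord_bot (subordP S)) (le0x b)).
Qed.

Lemma subord_lex1 {dA dB} (A : ctbDistrLatticeType dA)
    (B : ctbDistrLatticeType dB) (S : subordination A B) a : S a \top.
Proof.
exact: (subord_le (subordP S) (lex1 a) (subord_top (subordP S)) (lexx _)).
Qed.

Lemma subord_join2 {dA dB} (A : ctbDistrLatticeType dA)
    (B : ctbDistrLatticeType dB) (S : subordination A B) a a' b b' :
  S a b -> S a' b' -> S (a `|` a') (b `|` b').
Proof.
move=> ab ab'; apply: (subord_join (subordP S)).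
  exact: (subord_le (subordP S) (lexx _) ab (leUl _ _)).
exact: (subord_le (subordP S) (lexx _) ab' (leUr _ _)).
Qed.

Lemma subord_meet2 {dA dB} (A : ctbDistrLatticeType dA)
    (B : ctbDistrLatticeType dB) (S : subordination A B) a a' b b' :
  S a b -> S a' b' -> S (a `&` a') (b `&` b').
Proof.
move=> ab ab'; apply: (subord_meet (subordP S)).
  exact: (subord_le (subordP S) (leIl _ _) ab (lexx _)).
exact: (subord_le (subordP S) (leIr _ _) ab' (lexx _)).
Qed.

Lemma subord_joins_meets {dA dB} (A : ctbDistrLatticeType dA)
    (B : ctbDistrLatticeType dB) (S : subordination A B) (I J : eqType)
    (r : seq I) (r' : seq J) (f : I -> A) (g : J -> B) :
  (forall i, i \in r -> forall j, j \in r' -> S (f i) (g j)) ->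
  S (\join_(i <- r) f i) (\meet_(j <- r') g j).
Proof.
move=> fg; rewrite big_seq; apply: (big_ind (fun x => S x _)).
- exact: subord_le0x.
- by move=> x y; exact: (subord_join (subordP S)).
move=> i ir; rewrite big_seq; apply: (big_ind (fun y => S _ y)).
- exact: subord_lex1.
- by move=> x y; exact: (subord_meet (subordP S)).
- by move=> j; exact: fg.
Qed.

Lemma leI_compl {d} (B : ctbDistrLatticeType d) (x y z : B) :
  (x `&` ~` y <= z) = (x <= y `|` z).
Proof.
apply/idP/idP => [xyz|xyz].
  by rewrite -[x]meetx1 -(joinxC y) meetUr leU2 // leIr.
apply: le_trans (leI2 xyz (lexx _)) _.
by rewrite meetUl meetxC join0x leIl.
Qed.

(** * The Egli-Milner lifting *)

(** Under duality, the two clauses say that every point of [G] is related to a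
    point of [F], and that every point of [F] is related to a point of [G]. *)
Definition egli_milner {dA dB} (A : ctbDistrLatticeType dA)
    (B : ctbDistrLatticeType dB) (S : subordination A B)
    (F : A -> Prop) (G : B -> Prop) : Prop :=
  (forall a b, S a b -> F a -> G b) /\
  (forall a b, S a b -> G (~` b) -> F (~` a)).

(** The dual of the Egli-Milner lifting; the empty closed set is a point of the
    hyperspace, so improper filters are included. *)
Definition em_le {dA dB} (A : ctbDistrLatticeType dA)
    (B : ctbDistrLatticeType dB) (S : subordination A B)
    (x : K A) (y : K B) : Prop :=
  forall F G, is_filter F -> is_filter G -> egli_milner S F G ->
    kpt F x -> kpt G y.

Section EgliMilner.
Context {dA dB} (A : ctbDistrLatticeType dA) (B : ctbDistrLatticeType dB)
  (S : subordination A B).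

Lemma em_le_is_subordination : is_subordination (em_le S).
Proof.
split.
- move=> F G FP GP _.
  by rewrite -kdia0 (kpt_dia FP) compl0 => /asboolPn[]; exact: filter_top FP.
- move=> F G FP GP _ _.
  by rewrite -kbox1 (kpt_box GP); apply/asboolP; exact: filter_top GP.
- move=> a b c ac bc F G FP GP FG; rewrite (kpt_join FP) => /orP[].
    exact: ac FP GP FG.
  exact: bc FP GP FG.
- move=> a c e ac ae F G FP GP FG Fa; rewrite (kpt_meet GP).
  by rewrite (ac _ _ FP GP FG Fa) (ae _ _ FP GP FG Fa).
- move=> a b c e ab bc ce F G FP GP FG Fa.
  exact: (kpt_le GP ce (bc _ _ FP GP FG (kpt_le FP ab Fa))).
Qed.

Lemma em_le_box a b : S a b -> em_le S (kbox a) (kbox b).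
Proof.
move=> ab F G FP GP [FG _]; rewrite (kpt_box FP) (kpt_box GP) => /asboolP Fa.
by apply/asboolP; exact: FG ab Fa.
Qed.

Lemma em_le_dia a b : S a b -> em_le S (kdia a) (kdia b).
Proof.
move=> ab F G FP GP [_ GF]; rewrite (kpt_dia FP) (kpt_dia GP) => /asboolPn Fa.
by apply/asboolPn => Gb; apply: Fa; exact: GF ab Gb.
Qed.

(** If both conditions fail for [p = (a, bs)] and [q = (c, es)], let [F] be the
    set of points of [a] related to some point outside [c], and [G] the set of
    points outside [c] related to some point of [a].  This is an Egli-Milner
    pair.  Since each [b] in [bs] lies below [a] and is not in relation [S] with
    [c], it meets [F]; dually [G] is not included in any [e] of [es].  So [F]
    satisfies the term [p] while [G] refutes the term [q]. *)
Lemma em_le_nf (x : K A) (y : K B) s t :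
  em_le S x y -> is_dnf x s -> is_cnf y t ->
  forall p, p \in s -> forall q, q \in t -> box_cond S p q \/ dia_cond S p q.
Proof.
move=> xy [xs sP] [yt tP] p ps q qt; apply: contrapT => /not_orP[nbox ndia].
have SP := subordP S.
pose F u := exists2 f, S f q.1 & p.1 `&` ~` f <= u.
pose G v := exists2 g, S p.1 g & g `&` ~` q.1 <= v.
have FP : is_filter F.
  split=> [|u v [f Sf fu] [g Sg gv]|u v uv [f Sf fu]].
  - by exists \bot; [exact: subord_le0x|exact: lex1].
  - exists (f `|` g); first exact: (subord_join SP).
    by rewrite complU lexI (le_trans _ fu) ?(le_trans _ gv) // leI2 ?leIl ?leIr.
  - by exists f => //; exact: le_trans uv.
have GP : is_filter G.
  split=> [|u v [f Sf fu] [g Sg gv]|u v uv [f Sf fu]].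
  - by exists \top; [exact: subord_lex1|exact: lex1].
  - exists (f `&` g); first exact: (subord_meet SP).
    by rewrite lexI (le_trans _ fu) ?(le_trans _ gv) // leI2 ?leIl ?leIr.
  - by exists f => //; exact: le_trans uv.
have FG : egli_milner S F G.
  split=> a b ab.
    move=> [f Sf]; rewrite leI_compl => pfa.
    exists (q.1 `|` b); last by rewrite leI_compl.
    exact: (subord_le SP pfa (subord_join2 Sf ab) (lexx _)).
  move=> [g Sg gqb]; exists (p.1 `&` a); last first.
    by rewrite complI meetUr meetxC join0x leIr.
  apply: (subord_le SP (lexx _) (subord_meet2 Sg ab)).
  by rewrite -[b in leLHS]complK leI_compl joinC -leI_compl.
have Fx : kpt F x.
  rewrite xs; apply/(kpt_dnfP FP); exists p; split=> //.
    by exists \bot; [exact: subord_le0x|exact: leIl].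
  move=> b bp [f Sf fb]; apply: ndia; exists b => //.
  apply: (subord_le SP _ Sf (lexx _)).
  have [_ bp1] := sP _ ps _ bp.
  rewrite -[f]complK -disj_leC -lex0 -(meetxC b) lexI leIl /=.
  by apply: le_trans fb; rewrite leI2.
have := xy _ _ FP GP FG Fx; rewrite yt; apply/negP/(kpt_cnfPn GP).
exists q; split=> //; first by exists \top; [exact: subord_lex1|exact: leIr].
move=> e eq [g Sg]; rewrite leI_compl => gqe; apply: nbox; exists e => //.
apply: (subord_le SP (lexx _) Sg (le_trans gqe _)).
by have [qe _] := tP _ qt _ eq; rewrite leUx qe lexx.
Qed.

(** Each pair of terms of the two normal forms is itself a pair of elements in
    normal form, related by the box relation or by the diamond relation; an
    upper bound of both therefore relates the join to the meet. *)
Lemma ks_subordP x y : ks_subord S x y <-> em_le S x y.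
Proof.
split.
  move=> /(_ (Subordination em_le_is_subordination)).
  apply;
    move=> {}x {}y [s [t [[-> _] [-> _] st]]] F G FP GP [FG GF];
    move=> /(kpt_dnfP FP)[p [ps Fp pP]]; apply: contraT;
    move=> /(kpt_cnfPn GP)[q [qt Gq qP]].
    have [e eq Se] := st _ ps _ qt.
    by case: (qP e eq); exact: FG Se Fp.
  have [b bp Sb] := st _ ps _ qt.
  by case: (pP b bp); exact: GF Sb Gq.
move=> xy; have [s sP] := dnf_exists x; have [t tP] := cnf_exists y.
have st := em_le_nf xy sP tP.
case: sP tP => [-> sP] [-> tP]; apply: subord_joins_meets => p ps q qt.
have pP : is_dnf (kbox p.1 `&` \meet_(b <- p.2) kdia b) [:: p].
  split; first by rewrite /dnf_val big_seq1.
  by move=> p'; rewrite inE => /eqP ->; exact: sP.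
have qP : is_cnf (kdia q.1 `|` \join_(e <- q.2) kbox e) [:: q].
  split; first by rewrite /cnf_val big_seq1.
  by move=> q'; rewrite inE => /eqP ->; exact: tP.
by case: (st _ ps _ qt) => pq U boxU diaU; [apply: boxU|apply: diaU];
  exists [:: p], [:: q]; split=> // p'; rewrite inE => /eqP -> q';
  rewrite inE => /eqP ->.
Qed.

(** To bound [ks_subord S] by another subordination, it is enough to look at the
    symbols: the box condition involves one box on each side, the diamond
    condition one diamond on each side, and the remaining members of the two
    terms only make the first smaller and the second larger. *)
Lemma ks_subord_sub (U : subordination (K A) (K B)) :
  (forall a b, S a b -> U (kbox a) (kbox b)) ->
  (forall a b, S a b -> U (kdia a) (kdia b)) ->
  subord_sub (ks_subord S) U.
Proof.
move=> boxU diaU x y /ks_subordP xy.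
have [s sP] := dnf_exists x; have [t tP] := cnf_exists y.
have st := em_le_nf xy sP tP.
case: sP tP => [-> _] [-> _]; apply: subord_joins_meets => p ps q qt.
case: (st _ ps _ qt) => [[e eq pe]|[b bp bq]].
  apply: (subord_le (subordP U) (leIl _ _) (boxU _ _ pe)).
  by apply: le_trans (leUr _ _); exact: joins_sup_seq.
apply: (subord_le (subordP U) _ (diaU _ _ bq) (leUl _ _)).
by apply: le_trans (leIr _ _) _; exact: meets_inf_seq.
Qed.

End EgliMilner.

(** * Identities and composites *)

Lemma kbox_le {d} (B : ctbDistrLatticeType d) (a b : B) :
  a <= b -> kbox a <= kbox b.
Proof. by move=> /meet_idPl <-; rewrite kboxI leIr. Qed.

Lemma ks_subord_id {d} (B : ctbDistrLatticeType d) :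
  ks_subord (subord_id B) = subord_id (K B).
Proof.
apply: subord_ext => x y; split.
  by apply: ks_subord_sub => a b /=; [exact: kbox_le|exact: kdia_le].
move=> /= xy; apply/ks_subordP => F G FP GP [FG GF].
have -> : F = G.
  apply/funext => a; apply/propext; split; first exact: FG (lexx a).
  by rewrite -[a]complK; exact: GF (lexx (~` a)).
exact: kpt_le.
Qed.

(** Egli-Milner liftings compose: the middle closed set consists of the points
    that are related to a point of [F] by [S] and to a point of [H] by [T].  Its
    filter is generated by the elements [b] and [~` b'] of the definition. *)
Lemma egli_milner_comp {dA dB dC} (A : ctbDistrLatticeType dA)
    (B : ctbDistrLatticeType dB) (C : ctbDistrLatticeType dC)
    (S : subordination A B) (T : subordination B C)
    (F : A -> Prop) (H : C -> Prop) :
  is_filter F -> is_filter H -> egli_milner (subord_comp S T) F H ->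
  exists G, [/\ is_filter G, egli_milner S F G & egli_milner T G H].
Proof.
move=> FP HP [FH HF]; have [SP TP] := (subordP S, subordP T).
pose G g := exists a b b' c,
  [/\ F a, S a b, T b' c, H (~` c) & b `&` ~` b' <= g].
have F1 := filter_top FP.
have H1 : H (~` \bot) by rewrite compl0; exact: filter_top HP.
exists G; split.
- split.
  + exists \top, \top, \bot, \bot; split=> //; first exact: subord_top SP.
    exact: subord_bot TP.
  + move=> u v [a [b [b' [c [Fa ab bc Hc bu]]]]].
    move=> [a1 [b1 [b1' [c1 [Fa1 ab1 bc1 Hc1 bv]]]]].
    exists (a `&` a1), (b `&` b1), (b' `|` b1'), (c `|` c1); split.
    * exact: (filter_meet FP).
    * exact: subord_meet2.
    * exact: subord_join2.
    * by rewrite complU; exact: (filter_meet HP).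
    by rewrite complU meetACA leI2.
  + move=> u v uv [a [b [b' [c [Fa ab bc Hc bu]]]]].
    by exists a, b, b', c; split=> //; exact: le_trans uv.
- split=> a' g a'g.
    move=> Fa'; exists a', g, \bot, \bot; split=> //; last exact: leIl.
    exact: subord_bot TP.
  move=> [a [b [b' [c [Fa ab bc Hc]]]]]; rewrite leI_compl => bg.
  have bgb' : b `&` g <= b'.
    by rewrite -[g]complK leI_compl joinC.
  have F' : F (~` (a `&` a')).
    apply: HF Hc; exists b'; split=> //.
    exact: (subord_le SP (lexx _) (subord_meet2 ab a'g) bgb').
  apply: (filter_le FP) (filter_meet FP Fa F').
  by rewrite complI meetUr meetxC join0x leIr.
- split=> g c' gc'.
    move=> [a [b [b' [c [Fa ab bc Hc]]]]]; rewrite leI_compl => bg.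
    have H' : H (c `|` c').
      apply: FH Fa; exists (b' `|` g); split; last exact: subord_join2.
      exact: (subord_le SP (lexx _) ab bg).
    apply: (filter_le HP) (filter_meet HP H' Hc).
    by rewrite leI_compl.
  move=> Hc'; exists \top, \top, g, c'; split=> //; last by rewrite leIr.
  exact: subord_top SP.
Qed.

Lemma ks_subord_comp {dA dB dC} (A : ctbDistrLatticeType dA)
    (B : ctbDistrLatticeType dB) (C : ctbDistrLatticeType dC)
    (S : subordination A B) (T : subordination B C) :
  ks_subord (subord_comp S T) = subord_comp (ks_subord S) (ks_subord T).
Proof.
apply: subord_ext => x z; split.
  apply: ks_subord_sub => a c [b [ab bc]].
    by exists (kbox b); split; apply/ks_subordP; exact: em_le_box.
  by exists (kdia b); split; apply/ks_subordP; exact: em_le_dia.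
move=> [y [/ks_subordP xy /ks_subordP yz]].
apply/ks_subordP => F H FP HP /(egli_milner_comp FP HP)[G [GP FG GH]] Fx.
exact: yz GP HP GH (xy _ _ FP GP FG Fx).
Qed.

Theorem theorem6p6 : is_functor BAS BAS KS_ob (@KS_hom).
Proof.
split=> [B|A B C S T]; first exact: ks_subord_id.
exact: ks_subord_comp.
Qed.
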